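(* Let $J\in\{[0,\infty),\mathbb{R}\}$ and let $X$ be a Banach space (real or complex in (i), complex in (ii)). Let $\mathfrak{g}(t)=e^{it^2}$ for $t\in\mathbb{R}$. (i) If $\phi: J\to X$ is an arbitrary function such that $\Delta_h\phi\in C_0(J,X)$ for each $h>0$, then $\phi\in UC(J,X)$. (ii) If $\phi: J\to X$ is an arbitrary function such that $\Delta_h(\mathfrak{g}\phi)\in \mathfrak{g}\,UC(J,X)$ for each $h>0$, then $\phi\in C(J,X)$.
   Context: For $f:J\to X$ and $h>0$, $(\Delta_h f)(t)=f(t+h)-f(t)$, $t\in J$. $C(J,X)$, $UC(J,X)$ and $C_0(J,X)$ denote respectively the spaces of continuous functions, uniformly continuous functions (not necessarily bounded), and continuous functions vanishing at infinity (that is, $f(t)\to 0$ as $|t|\to\infty$, $t\in J$) from $J$ to $X$. $\mathfrak{g}\,UC(J,X)=\{\mathfrak{g}u: u\in UC(J,X)\}$. *)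

(* Defs.v *)
From mathcomp Require Import all_boot all_order all_algebra.
From mathcomp Require Import all_classical all_reals all_analysis.
From mathcomp Require Export complex.

Set Implicit Arguments.
Unset Strict Implicit.
Unset Printing Implicit Defensive.

Import Order.TTheory GRing.Theory Num.Theory.
Import numFieldNormedType.Exports.

Local Open Scope classical_set_scope.
Local Open Scope complex_scope.
Local Open Scope ring_scope.

(* A function J -> X is represented by a total function R -> X of which only
   the values on J matter: each of the predicates below depends only on the
   restriction to J. The scalar field K is meant to be R or R[i]. *)

Definition Delta (R : realType) (K : numFieldType) (X : normedModType K)
  (h : R) (f : R -> X) : R -> X := fun t => f (t + h) - f t.

Definition C_ (R : realType) (K : numFieldType) (X : normedModType K)
  (J : set R) : set (R -> X) := [set f | {within J, continuous f}].

(* The entourages of [subspace J] relate distinct points only if both are in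
   J, so this is uniform continuity of the restriction of f to J. *)
Definition UC (R : realType) (K : numFieldType) (X : normedModType K)
  (J : set R) : set (R -> X) :=
  [set f | unif_continuous (f : subspace J -> X)].

(* The norm of X takes its values in K; for K = R[i], [0 < e] means that e is
   a positive real. *)
Definition C0 (R : realType) (K : numFieldType) (X : normedModType K)
  (J : set R) : set (R -> X) :=
  [set f | C_ J f /\
    forall e : K, 0 < e ->
      exists M : R, forall t : R, J t -> M < `|t| -> `|f t| < e].

(* t |-> exp (i t^2) *)
Definition chirp (R : realType) (t : R) : R[i] :=
  cos (t ^+ 2) +i* sin (t ^+ 2).

Definition chirpM (R : realType) (X : normedModType R[i]) (f : R -> X) :
  R -> X := fun t => chirp t *: f t.

Definition chirpUC (R : realType) (X : normedModType R[i]) (J : set R) :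
  set (R -> X) :=
  [set f | exists2 u : R -> X, UC J u & forall t, J t -> f t = chirpM u t].

(* Main.v *)
(* Whenever a sequence (s_n) satisfies Delta_x phi (s_n) -> 0 for each x > 0,
   the identity
     phi x - phi 0 = Delta_x phi (s_n) - (Delta_{s_n} phi x - Delta_{s_n} phi 0)
   shows that phi is a pointwise limit of continuous functions. By Baire's
   theorem phi has small oscillation somewhere, and the oscillation is invariant
   under translation because each Delta_h phi is continuous; so phi is
   continuous. It suffices that Delta_x phi (a_n) + Delta_x phi (b_n) -> 0.
   In (i) take a_n = b_n = n + 1; a second use of Baire's theorem makes the
   convergence Delta_h phi -> 0 at infinity uniform for h in an interval, hence
   for h near 0, and compactness handles bounded t.
   In (ii) apply this to g phi, with g(a_n) = 1, g(b_n) = -1 and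
   b_n - a_n -> 0: if Delta_x(g phi) = g u with u uniformly continuous, the sum
   is u(a_n) - u(b_n) -> 0. *)

Require Import Defs.
From mathcomp Require Import all_boot all_order all_algebra.
From mathcomp Require Import all_classical all_reals all_analysis.
From mathcomp Require Import ring lra.
Import Order.TTheory GRing.Theory Num.Theory.
Import numFieldNormedType.Exports.
Local Open Scope classical_set_scope.
Local Open Scope complex_scope.
Local Open Scope ring_scope.

(** * Continuity on [J] in epsilon-delta form, and a Baire category lemma *)

Lemma within_continuous_distP (R : realType) (K : numFieldType)
    (X : normedModType K) (J : set R) (f : R -> X) :
  {within J, continuous f} <->
  forall t, J t -> forall e : K, 0 < e -> exists2 d : R, 0 < d &
    forall s, J s -> `|t - s| < d -> `|f t - f s| < e.
Proof.
split=> [/subspace_continuousP fJ t Jt e e0|fJ].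
  have /cvgrPdist_lt/(_ e e0) := fJ t Jt.
  by rewrite near_withinE => /nbhs_ballP[d d0 fd]; exists d => // s Js ts; exact: fd.
apply/subspace_continuousP => t Jt; apply/cvgrPdist_lt => e e0.
rewrite near_withinE; apply/nbhs_ballP.
by have [d d0 fd] := fJ t Jt e e0; exists d => // s ts Js; exact: fd.
Qed.

Lemma UC_distP (R : realType) (K : numFieldType) (X : normedModType K)
    (J : set R) (f : R -> X) :
  UC J f <-> forall e : K, 0 < e -> exists2 d : R, 0 < d &
    forall s t, J s -> J t -> `|s - t| < d -> `|f s - f t| < e.
Proof.
split=> [uf e e0|uf E].
  have : entourage [set xy : X * X | `|xy.1 - xy.2| < e].
    by rewrite -entourage_from_ballE; exists e => // -[x y]; rewrite -ball_normE.
  move=> /uf[V]; rewrite -entourage_from_ballE => -[d /= d0 dV] VE.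
  exists d => // s t Js Jt st; apply: (VE (s, t)); right; split => //.
  by split => //; apply: dV; exact: st.
rewrite -entourage_from_ballE => -[e /= e0 eE].
have [d d0 fd] := uf e e0.
exists [set xy : R * R | ball xy.1 d xy.2].
  by rewrite -entourage_from_ballE; exists d.
move=> [s t] /= [st|[Js [Jt st]]]; apply: eE => /=; rewrite -ball_normE /=.
  by rewrite st subrr normr0.
exact: fd.
Qed.

Lemma halfline_upper (R : realType) (J : set R)
    (hJ : J = [set t : R | 0 <= t] \/ J = [set: R]) (s t : R) :
  J s -> s <= t -> J t.
Proof. by case: hJ => -> //=; exact: le_trans. Qed.

Lemma halfline_ge0 (R : realType) (J : set R)
    (hJ : J = [set t : R | 0 <= t] \/ J = [set: R]) (t : R) : 0 <= t -> J t.
Proof. by case: hJ => ->. Qed.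

Lemma halfline_closed (R : realType) (J : set R)
    (hJ : J = [set t : R | 0 <= t] \/ J = [set: R]) : closed J.
Proof.
case: hJ => ->; last exact: closedT.
exact: (@closed_ge R 0).
Qed.

Lemma C_cvg_at_gt (R : realType) (K : numFieldType) (X : normedModType K)
    (J : set R) (hJ : J = [set t : R | 0 <= t] \/ J = [set: R])
    (f : R -> X) (t x : R) :
  C_ J f -> J t -> t < x -> f y @[y --> x] --> f x.
Proof.
move=> /within_continuous_distP fJ Jt tx; apply/cvgrPdist_lt => e e0.
have JtU y : t <= y -> J y by exact: halfline_upper hJ _ _ Jt.
have [d d0 fd] := fJ x (JtU x (ltW tx)) e e0.
apply/nbhs_ballP; exists (Num.min d (x - t)) => /=.
  by rewrite lt_min d0 subr_gt0.
move=> y; rewrite /ball /= lt_min => /andP[yd yx]; apply: fd => //.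
by apply: JtU; move: yx; rewrite ltr_norml; lra.
Qed.

(** Otherwise, for every [n], the points beyond [c] at which the bound fails for some index in [P n]
    form an open set dense beyond [c]; Baire's theorem gives a point common to all of them, against
    the pointwise hypothesis. *)
Lemma baire_uniform_bound (R : realType) (K : numFieldType)
    (X : normedModType K) (T : Type) (P : nat -> T -> Prop)
    (F : T -> R -> X) (c : R) (e : K) :
  e \is Num.real ->
  (forall n i x, P n i -> c < x -> F i y @[y --> x] --> F i x) ->
  (forall x, c < x -> exists n, forall i, P n i -> `|F i x| <= e) ->
  exists n a b, [/\ c < a, a < b &
    forall x, a < x < b -> forall i, P n i -> `|F i x| <= e].
Proof.
move=> eR Fc Fe; apply: contrapT => noint.
(* Adjoining the points below [c] makes [U n] dense in the whole line, as Baire's theorem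
   requires. *)
pose U n := [set x : R | x < c] `|`
  [set x | c < x /\ exists2 i, P n i & e < `|F i x|].
have Uopen n : open (U n).
  apply: openU; first exact: open_lt.
  rewrite openE => x [cx [i Pi eFx]].
  have d0 : 0 < `|F i x| - e by rewrite subr_gt0.
  have /cvgrPdist_lt/(_ _ d0) Fx := Fc n i x Pi cx.
  rewrite /interior; near=> y; split; first by near: y; exact: lt_nbhsr.
  have Fxy : `|F i x - F i y| < `|F i x| - e by near: y.
  exists i => //; have := le_lt_trans (lerB_dist _ _) Fxy.
  by rewrite ltrD2l ltrN2.
have Udense n : dense (U n).
  move=> O [x Ox] oO; apply: contrapT => OU.
  have [xc|cx] := ltP x c; first by apply: OU; exists x; split => //; left.
  have /nbhs_ballP[d /= d0 dO] : nbhs x O by exact: open_nbhs_nbhs.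
  (* Starting strictly to the right of [x] keeps the interval beyond [c] even when [x = c]. *)
  apply: noint; exists n, (x + d / 3), (x + d / 2); split; [lra|lra|].
  move=> y /andP[xy yx] i Pi.
  rewrite real_leNgt//; apply/negP => eF; apply: OU; exists y; split.
    by apply: dO; rewrite /ball /= ltr_norml; apply/andP; split; lra.
  by right; split; [lra|exists i].
have [||x [/= cx Ux]] := @Baire R R^o U (fun n => conj (Uopen n) (Udense n))
    [set x | c < x].
- by exists (c + 1) => /=; rewrite ltrDl.
- exact: open_gt.
have [n Fn] := Fe x cx.
have [/= xc|[_ [i Pi]]] := Ux n I; first by have := lt_trans xc cx; rewrite ltxx.
by move=> /lt_le_trans /(_ (Fn i Pi)); rewrite ltxx.
Unshelve. all: by end_near.
Qed.

(** * Continuity of [phi] from its differences *)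

Lemma sum_differences_swap (V : zmodType) (a b c d p q : V) :
  a - p + (b - p) - (c - q + (d - q)) = a - c + (b - d) - (p - q) *+ 2.
Proof.
rewrite mulrnBl !mulr2n (addrACA a) (addrACA c) (addrACA a (- c)) -!opprD !opprB.
by rewrite addrACA [RHS]addrACA [- (p + p) - _]addrC.
Qed.

(* On x > 0 the function phi - phi 0 is the pointwise limit of the continuous
   functions -(1/2) G n, so by Baire's theorem its oscillation is small at some
   point beyond any given t; adding a continuous Delta h phi moves this point
   to t. *)
Lemma continuous_of_Delta (R : realType) (K : numFieldType)
    (X : normedModType K) (J : set R)
    (hJ : J = [set t : R | 0 <= t] \/ J = [set: R]) (phi : R -> X)
    (a b : nat -> R) :
  (forall h, 0 < h -> C_ J (Delta h phi)) ->
  (forall n, 0 < a n) -> (forall n, 0 < b n) ->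
  (forall x, 0 < x ->
    Delta x phi (a n) + Delta x phi (b n) @[n --> \oo] --> (0 : X)) ->
  C_ J phi.
Proof.
move=> dC a0 b0 dab; apply/within_continuous_distP => t Jt e e0.
pose G n x := Delta (a n) phi x + Delta (b n) phi x -
              (Delta (a n) phi 0 + Delta (b n) phi 0).
(* The two increments are swapped in each second difference; the two sequences account for the
   factor 2. *)
have GE n x : G n x = (Delta x phi (a n) + Delta x phi (b n)) -
    (phi x - phi 0) *+ 2.
  rewrite /G /Delta mulr2n !add0r (addrC (a n) x) (addrC (b n) x).
  exact: sum_differences_swap.
have Gcvg (x : R) : 0 < x -> G n x @[n --> \oo] --> - ((phi x - phi 0) *+ 2).
  move=> x0; rewrite -[X in _ --> X]add0r.
  rewrite (_ : G ^~ x = fun n => (Delta x phi (a n) + Delta x phi (b n)) -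
    (phi x - phi 0) *+ 2); last by apply/funext => n; exact: GE.
  by apply: cvgB; [exact: dab|exact: cvg_cst].
have J0 : J 0 by exact: (halfline_ge0 _ _ hJ).
(* An error [2 e'] at each of two points and [e'] for [G n] add up to [e], which bounds twice an
   increment of [phi]. *)
pose e' := e / 5.
have e'0 : 0 < e' by rewrite divr_gt0.
(* Points beyond [c] are positive, so [G n] converges there, and they are reached from [t] by a
   positive shift. *)
pose c := Num.max 0 t.
have c0 x : c < x -> 0 < x by rewrite /c gt_max => /andP[].
have GC n (x : R) : 0 < x -> G n y @[y --> x] --> G n x.
  move=> x0; apply: cvgB; last exact: cvg_cst.
  by apply: cvgD; apply: C_cvg_at_gt hJ _ _ _ (dC _ _) J0 x0.
(* Indexing by pairs [i, j >= n] turns the pointwise Cauchy property into a uniform bound on an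
   interval. *)
have [|k i x _ /c0 x0|x /c0 x0|n [p [q [cp pq Gpq]]]] := @baire_uniform_bound R K X
    (nat * nat)%type (fun n ij => (n <= ij.1)%N && (n <= ij.2)%N)
    (fun ij x => G ij.1 x - G ij.2 x) c e'.
- exact: gtr0_real.
- by apply: cvgB; exact: GC.
- have e2 : 0 < e' / 2 by rewrite divr_gt0.
  have /cvgrPdist_lt/(_ _ e2)[n _ Gn] := Gcvg x x0.
  exists n => -[i j] /= /andP[ni nj].
  rewrite (splitr e') (le_trans (ler_distD (- ((phi x - phi 0) *+ 2)) _ _))//.
  by rewrite lerD// ltW//; [rewrite distrC; exact: Gn i ni|exact: Gn j nj].
have Glim x : p < x < q -> `|G n x + (phi x - phi 0) *+ 2| <= e' *+ 2.
  move=> xpq; have /andP[px _] := xpq.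
  have /cvgrPdist_lt/(_ _ e'0)[m _ Gm] := Gcvg x (c0 _ (lt_trans cp px)).
  (* The index [maxn n m] is admissible in the Cauchy bound and close to the limit at [x]; [m]
     depends on [x] but leaves no trace in the conclusion. *)
  have := Gpq x xpq (n, maxn n m); rewrite /= leqnn leq_maxl => /(_ isT) G1.
  have := Gm (maxn n m); rewrite /= leq_maxr => /(_ isT) G2.
  rewrite -[X in _ + X]opprK (le_trans (ler_distD (G (maxn n m) x) _ _))//.
  by rewrite mulr2n lerD// distrC ltW.
pose x := (p + q) / 2.
have [px xq] : p < x /\ x < q by rewrite /x; lra.
have cx := lt_trans cp px.
pose h := x - t.
have h0 : 0 < h by rewrite subr_gt0; move: cx; rewrite gt_max => /andP[].
have e2 : 0 < e / 2 by rewrite divr_gt0.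
have [d1 d10 phi1] := (within_continuous_distP _ _ _ _ _).1 (dC h h0) t Jt _ e2.
have [d2 /= d20 G2] : exists2 d2, 0 < d2 & forall y, `|x - y| < d2 ->
    `|G n x - G n y| < e'.
  have /cvgrPdist_lt/(_ _ e'0)/nbhs_ballP[d2 d20 G2] :=
    GC n x (c0 _ (lt_trans cp px)).
  by exists d2.
exists (Num.min d1 (Num.min d2 ((q - p) / 2))) => [|s Js].
  by rewrite !lt_min d10 d20 /=; lra.
rewrite !lt_min => /and3P[ts1 ts2 tspq].
have tsh : `|x - (s + h)| = `|t - s| by congr Num.norm; rewrite /h; ring.
have shpq : p < s + h < q.
  by move: tspq; rewrite -tsh ltr_norml /x => /andP[? ?]; apply/andP; lra.
have Gx := Glim x (introT andP (conj px xq)).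
have Gs := Glim _ shpq.
have Gxs : `|G n x - G n (s + h)| < e' by apply: G2; rewrite tsh.
have phi2 : `|phi x - phi (s + h)| < e / 2.
  have : `|(phi x - phi (s + h)) *+ 2| < e.
    have -> : (phi x - phi (s + h)) *+ 2 = (G n x + (phi x - phi 0) *+ 2) -
        (G n (s + h) + (phi (s + h) - phi 0) *+ 2) - (G n x - G n (s + h)).
      by rewrite opprD addrACA [RHS]addrAC subrr add0r -mulrnBl opprB subrKA.
    have -> : e = e' *+ 2 + e' *+ 2 + e' by rewrite /e'; field.
    rewrite (le_lt_trans (ler_normB _ _))// ler_ltD//.
    by rewrite (le_trans (ler_normB _ _))// lerD.
  by rewrite normrMn -[X in X < _]mulr_natr => phi2; rewrite ltr_pdivlMr.
have -> : phi t - phi s = phi x - phi (s + h) -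
    (Delta h phi t - Delta h phi s).
  rewrite /Delta (_ : t + h = x); last by rewrite /h; ring.
  by rewrite !opprB addrA subrKA addrC subrKA.
rewrite (le_lt_trans (ler_normB _ _))// (splitr e) ltrD//.
exact: phi1.
Qed.

(** * Uniform continuity: part (i) *)

Lemma unif_continuous_segment (R : realType) (K : numFieldType)
    (X : normedModType K) (J : set R) (f : R -> X) (M : R) (e : K) :
  closed J -> C_ J f -> 0 < e -> exists2 d : R, 0 < d &
    forall s t, J s -> J t -> `|s| <= M -> `|s - t| < d -> `|f s - f t| < e.
Proof.
move=> Jcl /within_continuous_distP fJ e0.
have e2 : 0 < e / 2 by rewrite divr_gt0.
pose A := J `&` `[- M, M]%classic.
have cA : compact A.
  rewrite /A setIC; apply: compact_closedI => //.
  exact: segment_compact.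
(* Only [s] is confined to the compact set while [t] ranges over [J], so that a case distinction on
   [|s|] alone suffices later. *)
pose P (d s : R) := forall t, J t -> `|s - t| < d -> `|f s - f t| < e.
have : \forall d \near 0^'+, A `<=` P d.
  move/compact_near_coveringP/near_covering_withinP : cA; apply.
  move=> s [Js _]; have [d d0 fd] := fJ s Js _ e2.
  have d2 : 0 < d / 2 by lra.
  exists (ball s (d / 2), [set r | 0 < r < d / 2]) => /=.
    split; first exact: nbhsx_ballx.
    by near=> r; apply/andP; split; near: r; [exact: nbhs_right_gt|
      exact: nbhs_right_lt].
  move=> [s' r] /= [ss' /andP[r0 rd]] [Js' _] t Jt s't.
  rewrite (le_lt_trans (ler_distD (f s) _ _))// (splitr e) ltrD//.
    rewrite distrC; apply: fd => //; apply: lt_trans ss' _; lra.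
  apply: fd => //; rewrite (le_lt_trans (ler_distD s' _ _))//.
  by rewrite (splitr d) ltrD// (lt_trans s't).
move=> PA; near (0 : R)^'+ => d; exists d => [|s t Js Jt sM st].
  by near: d; exact: nbhs_right_gt.
have dA : A `<=` P d by near: d.
by apply: dA => //; split => //=; rewrite in_itv /= -ler_norml.
Unshelve. all: by end_near.
Qed.

Lemma UC_of_Delta_C0 (R : realType) (K : numFieldType)
    (X : normedModType K) (J : set R)
    (hJ : J = [set t : R | 0 <= t] \/ J = [set: R]) (phi : R -> X) :
  (forall h, 0 < h -> C0 J (Delta h phi)) -> UC J phi.
Proof.
move=> dC0.
have phiC : C_ J phi.
  apply: (@continuous_of_Delta _ _ _ _ hJ phi (fun n => n.+1%:R)
    (fun n => n.+1%:R)) => // [h h0|x x0]; first by have [] := dC0 h h0.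
  have [_ dx] := dC0 x x0.
  suff dcvg : Delta x phi n.+1%:R @[n --> \oo] --> (0 : X).
    by rewrite -[X in _ --> X]addr0; apply: cvgD.
  apply/cvgrPdist_lt => e /dx[M dM].
  near=> n; rewrite sub0r normrN; apply: dM.
    exact: (halfline_ge0 _ _ hJ).
  rewrite ger0_norm//; near: n.
  exists (Num.trunc `|M|) => // n /= Mn.
  rewrite (le_lt_trans (ler_norm M))// (lt_le_trans (truncnS_gt _))//.
  by rewrite ler_nat ltnS.
apply/UC_distP => e e0.
have e2 : 0 < e / 3 by rewrite divr_gt0.
(* Here the increment is the variable and the base point the index, so smallness far out becomes
   uniform for increments in [(a, b)]. *)
have [|m t x [Jt _] x0|x x0|n [a [b [a0 ab dab]]]] := @baire_uniform_bound R K X R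
    (fun n t => J t /\ n%:R < `|t|) (fun t h => Delta h phi t) 0 (e / 3).
- exact: gtr0_real.
- apply: cvgB; last exact: cvg_cst.
  apply: (@cvg_comp _ _ _ (fun h => t + h) phi _ (nbhs (t + x))).
    by apply: cvgD; [exact: cvg_cst|exact: cvg_id].
  by apply: C_cvg_at_gt hJ _ _ _ phiC Jt _; rewrite ltrDl.
- have [_ /(_ _ e2)[M dM]] := dC0 x x0.
  exists (Num.trunc `|M|).+1 => t [Jt Mt]; apply/ltW/dM => //.
  by rewrite (le_lt_trans (ler_norm M))// (lt_trans (truncnS_gt _)).
(* The extra 1 leaves room for a shift [h < 1]: from [|s| > n + 1] follows [|s + h| > n]. *)
have [d d0 dphi] := unif_continuous_segment _ _ _ _ _ (n%:R + 1) _
  (halfline_closed _ _ hJ) phiC e0.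
have far s h : J s -> 0 <= h < (b - a) / 2 -> h < 1 -> n%:R + 1 < `|s| ->
    `|Delta h phi s| < e.
  move=> Js /andP[h0 hab] h1 ns; pose m := (a + b) / 2.
  have Jsh : J (s + h) by apply: halfline_upper hJ _ _ Js _; rewrite lerDl.
  have nsh : n%:R < `|s + h|.
    have := lerB_normD s h; rewrite (ger0_norm h0); lra.
  (* A small increment [h] is traded for [m + h] and [m], both in [(a, b)] since [m] is the
     midpoint. *)
  have -> : Delta h phi s = Delta (m + h) phi s - Delta m phi (s + h).
    rewrite /Delta (_ : s + h + m = s + (m + h)); last by ring.
    by rewrite opprB [RHS]addrC subrKA.
  have -> : e = e / 3 + e / 3 + e / 3 by field.
  rewrite (le_lt_trans (ler_normB _ _))// ltr_pwDr// lerD//; apply: dab.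
  - by rewrite /m; apply/andP; split; lra.
  - by split => //; lra.
  - by rewrite /m; apply/andP; split; lra.
  - by split.
have near_le s t : J s -> J t -> s <= t ->
    `|s - t| < Num.min d (Num.min ((b - a) / 2) 1) -> `|phi s - phi t| < e.
  move=> Js Jt st; rewrite !lt_min => /and3P[std stab st1].
  have [sn|sn] := leP `|s| (n%:R + 1); first exact: dphi.
  have := far s (t - s) Js; rewrite /Delta [s + _]addrC subrK distrC; apply => //.
  - by move: stab; rewrite distrC ger0_norm ?subr_ge0 ?st.
  - by move: st1; rewrite distrC ger0_norm ?subr_ge0 ?st.
exists (Num.min d (Num.min ((b - a) / 2) 1)) => [|s t Js Jt st].
  by rewrite !lt_min d0 ltr01 andbT /=; lra.
have [le_st|/ltW le_ts] := leP s t; first exact: near_le.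
by rewrite distrC; apply: near_le => //; rewrite distrC.
Unshelve. all: by end_near.
Qed.

(** * The chirp and part (ii) *)

Lemma chirp_neq0 (R : realType) (t : R) : chirp t != 0.
Proof.
apply/eqP => -[cos0 sin0].
by have := cos2Dsin2 (t ^+ 2); rewrite cos0 sin0 expr0n addr0 => /eqP;
  rewrite eq_sym oner_eq0.
Qed.

Lemma chirp_continuous (R : realType) : continuous (fun t : R => chirp t : R[i]^o).
Proof.
move=> t; apply/cvgrPdist_lt => e; rewrite ltcE => /andP[/eqP/= e_im /= e_re].
(* Positivity in [R[i]] makes [e] real, equal to [r]; errors below [r / 2] in both coordinates give
   a modulus below [r]. *)
pose r := complex.Re e; have r2 : 0 < r / 2 by rewrite divr_gt0.
have sqrC : (s : R) ^+ 2 @[s --> t] --> t ^+ 2 by exact: exprn_continuous.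
have /cvgrPdist_lt/(_ _ r2) cosC : cos (s ^+ 2) @[s --> t] --> cos (t ^+ 2).
  exact: cvg_comp sqrC (@continuous_cos R _).
have /cvgrPdist_lt/(_ _ r2) sinC : sin (s ^+ 2) @[s --> t] --> sin (t ^+ 2).
  exact: cvg_comp sqrC (@continuous_sin R _).
have eE : e = r%:C.
  by rewrite /r; case: e e_im {r r2 e_re cosC sinC} => x y /= ->.
near=> s.
have cosL : `|cos (t ^+ 2) - cos (s ^+ 2)| < r / 2 by near: s.
have sinL : `|sin (t ^+ 2) - sin (s ^+ 2)| < r / 2 by near: s.
rewrite eE normc_def ltcR /=.
rewrite -[ltRHS]ger0_norm ?ltW// -sqrtr_sqr ltr_sqrt ?exprn_gt0//.
move: cosL sinL; rewrite !ltr_norml => /andP[? ?] /andP[? ?]; nra.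
Unshelve. all: by end_near.
Qed.

Lemma chirpM_continuous (R : realType) (X : normedModType R[i]) (J : set R)
    (f : R -> X) : C_ J f -> C_ J (chirpM f).
Proof.
move=> /subspace_continuousP fC; apply/subspace_continuousP => t Jt.
apply: cvgZ; last exact: fC.
exact: cvg_within_filter (@chirp_continuous R t).
Qed.

(** The chirp never vanishes, so multiplying by its continuous inverse recovers [f]. *)
Lemma chirpM_continuousI (R : realType) (X : normedModType R[i]) (J : set R)
    (f : R -> X) : C_ J (chirpM f) -> C_ J f.
Proof.
move=> /subspace_continuousP fC; apply/subspace_continuousP => t Jt.
have fE s : f s = (chirp s)^-1 *: chirpM f s.
  by rewrite /chirpM scalerA mulVf ?scale1r// chirp_neq0.
have -> : f = fun s => (chirp s)^-1 *: chirpM f s by apply/funext => s.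
apply: cvgZ; last by rewrite -/(chirpM f); exact: fC.
apply: cvgV; first exact: chirp_neq0.
exact: cvg_within_filter (@chirp_continuous R t).
Qed.

Lemma mulrn_2pi_ge0 (R : realType) (n : nat) : 0 <= pi *+ 2 *+ n :> R.
Proof. by do 2 apply: mulrn_wge0; exact: pi_ge0. Qed.

(* The n-th points where the chirp equals 1 and -1; they get close to each
   other as n grows. *)
Definition chirp_top (R : realType) (n : nat) : R :=
  Num.sqrt (pi *+ 2 *+ n.+1).

Definition chirp_bottom (R : realType) (n : nat) : R :=
  Num.sqrt (pi + pi *+ 2 *+ n.+1).

Lemma chirp_top_gt0 (R : realType) (n : nat) : 0 < chirp_top R n.
Proof. by rewrite sqrtr_gt0; do 2 (rewrite pmulrn_lgt0//); exact: pi_gt0. Qed.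

Lemma chirp_bottom_gt0 (R : realType) (n : nat) : 0 < chirp_bottom R n.
Proof. by rewrite sqrtr_gt0 ltr_wpDr ?mulrn_2pi_ge0// pi_gt0. Qed.

Lemma chirp_at_top (R : realType) (n : nat) : chirp (chirp_top R n) = 1.
Proof.
rewrite /chirp /chirp_top sqr_sqrtr ?mulrn_2pi_ge0// -[_ *+ n.+1]add0r.
by rewrite (periodicn (@cosD2pi R)) (periodicn (@sinD2pi R)) cos0 sin0.
Qed.

Lemma chirp_at_bottom (R : realType) (n : nat) :
  chirp (chirp_bottom R n) = -1.
Proof.
rewrite /chirp /chirp_bottom sqr_sqrtr; last by rewrite addr_ge0 ?pi_ge0 ?mulrn_2pi_ge0.
rewrite (periodicn (@cosD2pi R)) (periodicn (@sinD2pi R)) cospi sinpi.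
by apply/eqP; rewrite eq_complex /= oppr0 !eqxx.
Qed.

(** The squares of the two points differ by [pi], so their distance is at most
    [pi / chirp_top R n]. *)
Lemma chirp_top_bottom_cvg (R : realType) :
  chirp_bottom R n - chirp_top R n @[n --> \oo] --> (0 : R).
Proof.
(* This threshold forces [A > (pi / e) ^+ 2], that is, [pi < e * Num.sqrt A]. *)
apply/cvgrPdist_lt => e e0; exists (Num.trunc ((pi / e) ^+ 2)) => // n /= en.
have p2 : 2 <= pi :> R by exact: pi_ge2.
have A0 := mulrn_2pi_ge0 R n.+1; rewrite /chirp_bottom /chirp_top; set A := pi *+ 2 *+ n.+1 in A0 *.
have eA : (pi / e) ^+ 2 < A.
  apply: (lt_le_trans (truncnS_gt _)); apply: (@le_trans _ _ n.+1%:R).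
    by rewrite ler_nat ltnS.
  by rewrite /A; apply: ler_wMn2r; rewrite mulr2n; lra.
have sA2 : Num.sqrt A ^+ 2 = A by rewrite sqr_sqrtr.
have sB2 : Num.sqrt (pi + A) ^+ 2 = pi + A by rewrite sqr_sqrtr; lra.
have sAB : Num.sqrt A <= Num.sqrt (pi + A) by rewrite ler_wsqrtr; lra.
have sA0 : 0 <= Num.sqrt A by exact: sqrtr_ge0.
have sA : pi < e * Num.sqrt A.
  rewrite mulrC -ltr_pdivrMr// -[ltLHS]ger0_norm ?divr_ge0 ?ltW//; last lra.
  by rewrite -sqrtr_sqr ltr_sqrt//; apply: le_lt_trans eA; exact: sqr_ge0.
rewrite sub0r normrN ger0_norm ?subr_ge0// ltNge; apply/negP => eAB.
have := ler_wpM2r sA0 eAB; nra.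
Qed.

Lemma continuous_of_Delta_chirpUC (R : realType) (X : normedModType R[i])
    (J : set R) (hJ : J = [set t : R | 0 <= t] \/ J = [set: R]) (phi : R -> X) :
  (forall h, 0 < h -> chirpUC J (Delta h (chirpM phi))) -> C_ J phi.
Proof.
move=> dUC; apply: chirpM_continuousI.
apply: (@continuous_of_Delta _ _ _ _ hJ (chirpM phi)
  (chirp_top R) (chirp_bottom R)) => [h /dUC[u uUC uE]|n|n|x].
- have uC : C_ J (chirpM u).
    apply: chirpM_continuous; apply/within_continuous_distP => t Jt e e0.
    have [d d0 ud] := (UC_distP _ _ _ _ _).1 uUC e e0.
    by exists d => // s Js; exact: ud.
  apply/within_continuous_distP => t Jt e e0.
  have [d d0 ud] := (within_continuous_distP _ _ _ _ _).1 uC t Jt e e0.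
  by exists d => // s Js ts; rewrite !uE//; exact: ud.
- exact: chirp_top_gt0.
- exact: chirp_bottom_gt0.
move=> /dUC[u /UC_distP uUC uE]; apply/cvgrPdist_lt => e /uUC[d d0 ud].
have /cvgrPdist_lt/(_ _ d0) := chirp_top_bottom_cvg R; apply: filterS => n abd.
have Jt : J (chirp_top R n) := halfline_ge0 _ _ hJ _ (ltW (chirp_top_gt0 R n)).
have Jb : J (chirp_bottom R n) :=
  halfline_ge0 _ _ hJ _ (ltW (chirp_bottom_gt0 R n)).
rewrite !uE// /chirpM chirp_at_top chirp_at_bottom scale1r scaleN1r.
rewrite sub0r normrN; apply: ud => //.
by move: abd; rewrite sub0r normrN distrC.
Qed.

Theorem lemma2p5 (R : realType) (J : set R)
    (hJ : J = [set t : R | 0 <= t] \/ J = [set: R]) :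
  (* (i), real and complex X *)
  ((forall (X : completeNormedModType R) (phi : R -> X),
      (forall h : R, 0 < h -> C0 J (Delta h phi)) -> UC J phi) /\
   (forall (X : completeNormedModType R[i]) (phi : R -> X),
      (forall h : R, 0 < h -> C0 J (Delta h phi)) -> UC J phi)) /\
  (* (ii) *)
  (forall (X : completeNormedModType R[i]) (phi : R -> X),
      (forall h : R, 0 < h -> chirpUC J (Delta h (chirpM phi))) -> C_ J phi).
Proof.
split; first by split=> X phi; exact: UC_of_Delta_C0.
by move=> X phi; exact: continuous_of_Delta_chirpUC.
Qed.
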